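(* For each positive integer $n$ there exists a uniformly diffusive function $u_n:\{0,1\}^n\to\{0,1\}^n$, that is, an injective function such that the distribution of the Hamming distances $h(u_n(x),u_n(y))$, over all pairs $\{x,y\}\in E_n$, is uniform on $\{1,2,3,\ldots,n\}$. Moreover, the output dimension can be taken to be any integer $m\ge n$: for every integer $m\ge n$ there exists an injective function $u:\{0,1\}^n\to\{0,1\}^m$ such that the distribution of the Hamming distances $h(u(x),u(y))$, over all pairs $\{x,y\}\in E_n$, is uniform on $\{1,2,3,\ldots,n\}$.
   Context: For a positive integer $n$, $\{0,1\}^n$ denotes the set of $n$-bit binary strings. The Hamming distance $h(x,y)$ between two strings $x,y$ of the same length is the number of positions at which they differ. $E_n$ denotes the set of unordered pairs $\{x,y\}$ of elements of $\{0,1\}^n$ with $h(x,y)=1$ (the edges of the $n$-dimensional hypercube); it has $n2^{n-1}$ elements. For a function $u$ on $\{0,1\}^n$ with values in $\{0,1\}^m$, saying that the distribution of Hamming distances between outputs of pairs in $E_n$ is uniform on $\{1,2,\ldots,n\}$ means that for each $d\in\{1,2,\ldots,n\}$ there are exactly $2^{n-1}$ pairs $\{x,y\}\in E_n$ with $h(u(x),u(y))=d$ (so every pair in $E_n$ has output distance in $\{1,\ldots,n\}$). *)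

(* Defs.v *)
From mathcomp Require Import all_boot.

Set Implicit Arguments.
Unset Strict Implicit.
Unset Printing Implicit Defensive.

Notation bitstring n := (n.-tuple bool).

Definition hamming (n : nat) (x y : bitstring n) : nat :=
  #|[set i : 'I_n | tnth x i != tnth y i]|.

(* An edge {x, y} is the two-element set [set x; y], hence unordered. *)
Definition hypercube_edges (n : nat) : {set {set bitstring n}} :=
  [set e | [exists x, exists y, (e == [set x; y]) && (hamming x y == 1)]].

(* The endpoints of an edge are determined up to a swap and [hamming] is
   symmetric, so the output distance of an edge is well defined. *)
Definition edges_at_output_distance (n m : nat)
    (u : bitstring n -> bitstring m) (d : nat) : {set {set bitstring n}} :=
  [set e in hypercube_edges n |
    [exists x, exists y, (e == [set x; y]) && (hamming (u x) (u y) == d)]].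

(* There are n * 2 ^ n.-1 edges, so these n counts exhaust them: no edge has
   an output distance outside {1, ..., n}. *)
Definition uniform_output_distances (n m : nat)
    (u : bitstring n -> bitstring m) : Prop :=
  forall d : nat, 1 <= d <= n -> #|edges_at_output_distance u d| = 2 ^ n.-1.

Definition uniformly_diffusive (n : nat) (u : bitstring n -> bitstring n) :
    Prop :=
  injective u /\ uniform_output_distances u.

(* Main.v *)
(** Over F_2, a linear map sends every hypercube edge in direction [i] to a pair
    at distance the weight of its [i]-th column, and there are 2^(n-1) edges in
    each direction.  So it suffices to take an injective matrix whose column
    weights are 1, ..., n: the triangular one with [i]-th column 1^i 0^(m-i). *)
Require Import Defs.
From mathcomp Require Import all_boot.

Lemma hammingxx n (x : bitstring n) : hamming x x = 0.
Proof. by apply/eqP; rewrite cards_eq0; apply/eqP/setP=> k; rewrite !inE eqxx. Qed.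

Lemma hammingC n (x y : bitstring n) : hamming x y = hamming y x.
Proof. by apply: eq_card => k; rewrite !inE eq_sym. Qed.

Section Flip.

Variable n : nat.
Implicit Types (x y : bitstring n) (i k : 'I_n).

Definition flip i x : bitstring n := [tuple (k == i) (+) tnth x k | k < n].

Lemma tnth_flip i x k : tnth (flip i x) k = (k == i) (+) tnth x k.
Proof. by rewrite tnth_mktuple. Qed.

Lemma flipK i : involutive (flip i).
Proof. by move=> x; apply: eq_from_tnth => k; rewrite !tnth_flip addKb. Qed.

Lemma hamming_eq1P x y : reflect (exists i, y = flip i x) (hamming x y == 1).
Proof.
apply: (iffP cards1P) => -[i].
  move=> /setP Di; exists i; apply: eq_from_tnth => k.
  by move: (Di k); rewrite tnth_flip !inE; do 2 case: (tnth _ k) => /=; case: (k == i).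
move->; exists i; apply/setP=> k; rewrite !inE tnth_flip.
by case: (tnth x k); case: (k == i).
Qed.

(** Flipping bit [i] exchanges the strings where it is false with those where it is true, so each
    class is half of the cube. *)
Lemma card_bit_false i : #|[set x | ~~ tnth x i]| = 2 ^ n.-1.
Proof.
have flipC : [set x | tnth x i] = flip i @: [set x | ~~ tnth x i].
  apply/setP=> x; rewrite -[x in RHS](flipK i) mem_imset; last exact: inv_inj (flipK i).
  by rewrite !inE tnth_flip eqxx addTb negbK.
have card2 : #|[set x | ~~ tnth x i]|.*2 = 2 ^ n.
  rewrite -card_bool -card_tuple -(cardsC [set x | tnth x i]).
  rewrite flipC card_imset; last exact: inv_inj (flipK i).
  rewrite -flipC -addnn; congr (_ + _).
  by apply: eq_card => x; rewrite !inE.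
have n_gt0 : 0 < n by apply: leq_ltn_trans (ltn_ord i).
by apply: double_inj; rewrite card2 -mul2n -expnS prednK.
Qed.

Definition direction_edges i : {set {set bitstring n}} :=
  [set [set x; flip i x] | x : bitstring n].

(** Each edge in direction [i] has exactly one endpoint whose bit [i] is false, and that endpoint
    serves as its canonical representative. *)
Lemma card_direction_edges i : #|direction_edges i| = 2 ^ n.-1.
Proof.
rewrite -(card_bit_false i).
have -> : direction_edges i =
    [set [set x; flip i x] | x in [set x : bitstring n | ~~ tnth x i]].
  apply/setP=> e; apply/imsetP/imsetP=> -[x _ ->]; last by exists x.
  have [xi | xi] := boolP (tnth x i); last by exists x; rewrite ?inE.
  by exists (flip i x); rewrite ?inE ?tnth_flip ?eqxx ?xi // flipK setUC.
apply: card_in_imset => x y; rewrite !inE => xi yi /setP/(_ x).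
rewrite !inE eqxx /= => /esym/orP[/eqP // | /eqP xE].
by move: xi; rewrite xE tnth_flip eqxx addTb yi.
Qed.

(** Since [w] is injective, the output distance of an edge reveals its direction. *)
Lemma edges_at_direction m (u : bitstring n -> bitstring m) (w : 'I_n -> nat) i :
    injective w -> 0 < w i ->
    (forall k x, hamming (u x) (u (flip k x)) = w k) ->
  edges_at_output_distance u (w i) = direction_edges i.
Proof.
move=> w_inj wi_gt0 uflip; apply/setP=> e; rewrite !inE.
apply/andP/imsetP=> [[]|[x _ ->]]; last first.
  split; apply/existsP; exists x; apply/existsP; exists (flip i x); rewrite eqxx /=.
    by apply/hamming_eq1P; exists i.
  by rewrite uflip.
move=> /existsP[x /existsP[y /andP[/eqP-> /hamming_eq1P[k ->]]]].
move=> /existsP[a /existsP[b /andP[/eqP eE /eqP uab]]].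
exists x => //; congr [set x; flip _ x]; apply: w_inj.
(* The pair [a], [b] witnessing the output distance may list the endpoints in either order. The
   cases [a = b] would give distance 0, against [0 < w i]. *)
have : a \in [set x; flip k x] by rewrite eE !inE eqxx.
have : b \in [set x; flip k x] by rewrite eE !inE eqxx orbT.
move: wi_gt0; rewrite -uab !inE => u_gt0 /orP[]/eqP bE /orP[]/eqP aE; move: u_gt0.
- by rewrite aE bE hammingxx.
- by rewrite aE bE hammingC uflip.
- by rewrite aE bE uflip.
by rewrite aE bE hammingxx.
Qed.

End Flip.

(** Row [j] of the triangular matrix. The index [j] is a natural number rather than an ordinal, so
    that rows from [n] on make sense and are zero: they pad the output when [m > n]. *)
Definition suffix_xor {n : nat} (x : bitstring n) (j : nat) : bool :=
  \big[addb/false]_(i < n | j <= i) tnth x i.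

Definition suffix_xors {n : nat} (m : nat) (x : bitstring n) : bitstring m :=
  [tuple suffix_xor x j | j < m].

Lemma suffix_xor_ge n (x : bitstring n) j : n <= j -> suffix_xor x j = false.
Proof.
by move=> nj; apply: big_pred0 => i; rewrite leqNgt (leq_trans (ltn_ord i)).
Qed.

Lemma suffix_xor_recl n (x : bitstring n) (i : 'I_n) :
  suffix_xor x i = tnth x i (+) suffix_xor x i.+1.
Proof.
rewrite /suffix_xor (bigD1 i) //=; congr (_ (+) _).
by apply: eq_bigl => k; rewrite ltn_neqAle andbC eq_sym.
Qed.

(** Back substitution: bit [i] of the input is the xor of the suffix xors at [i] and [i.+1]. *)
Lemma suffix_xors_inj n m : n <= m -> injective (@suffix_xors n m).
Proof.
move=> le_nm x y uxy.
(* Equality is needed at every natural [j]: for the last bit, [i.+1 = n] is not an output position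
   when [m = n]. *)
have eq_suffix j : suffix_xor x j = suffix_xor y j.
  have [lt_jm | le_mj] := ltnP j m; last first.
    by rewrite !suffix_xor_ge // (leq_trans le_nm).
  by have := congr1 (fun t => tnth t (Ordinal lt_jm)) uxy; rewrite !tnth_mktuple.
apply: eq_from_tnth => i; have := eq_suffix i.
by rewrite !suffix_xor_recl eq_suffix => /addIb.
Qed.

(** By linearity, a flip of bit [i] adds column [i], whose entry in row [j] is [j <= i]. *)
Lemma suffix_xor_flip n (i : 'I_n) x j :
  suffix_xor (flip n i x) j = (j <= i) (+) suffix_xor x j.
Proof.
rewrite /suffix_xor (eq_bigr _ (fun k _ => tnth_flip n i x k)) big_split /=.
congr (_ (+) _); have [ji | ij] := boolP (j <= i).
  by rewrite (bigD1 i) //= eqxx big1 // => k /andP[_ /negPf].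
by rewrite big1 // => k jk; apply: contraNF ij => /eqP <-.
Qed.

Lemma hamming_suffix_xors_flip n m (i : 'I_n) x :
  n <= m -> hamming (suffix_xors m x) (suffix_xors m (flip n i x)) = i.+1.
Proof.
move=> le_nm; rewrite /hamming -[RHS]card_ord -!sum1_card.
(* The outputs differ exactly at the positions [j < i.+1], all of which exist in the output because
   [i < n <= m]. *)
rewrite (big_ord_widen m (fun=> 1)) ?(leq_trans _ le_nm) //.
apply: eq_bigl => j; rewrite inE !tnth_mktuple suffix_xor_flip ltnS.
by case: (suffix_xor x j); case: (j <= i).
Qed.

Lemma uniform_suffix_xors n m :
  n <= m -> uniform_output_distances (@suffix_xors n m).
Proof.
(* Directions count from 0, so distance [d.+1] belongs to direction [d]. *)
move=> le_nm [//|d] lt_dn; pose w (i : 'I_n) := i.+1.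
rewrite -(card_direction_edges n (Ordinal lt_dn)).
rewrite -(edges_at_direction n m (suffix_xors m) w) //.
  by move=> i k [/val_inj].
by move=> i x; apply: hamming_suffix_xors_flip.
Qed.

Theorem theorem10 (n : nat) (hn : 0 < n) :
  (exists u : bitstring n -> bitstring n, uniformly_diffusive u) /\
  (forall m : nat, n <= m ->
     exists u : bitstring n -> bitstring m,
       injective u /\ uniform_output_distances u).
Proof.
have diffusive m : n <= m ->
    exists u : bitstring n -> bitstring m, injective u /\ uniform_output_distances u.
  move=> le_nm; exists (suffix_xors m).
  by split; [exact: suffix_xors_inj | exact: uniform_suffix_xors].
by split; [exact: (diffusive n (leqnn n)) | exact: diffusive].
Qed.
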